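(* Let $E=(E^0,E^1,r,s)$ be a topological graph with $E^0_{\mathrm{sg}}=\varnothing$, and let $\Gamma(E^\infty,\sigma)$ be its boundary path groupoid. Then the interior $\mathrm{Iso}(\Gamma(E^\infty,\sigma))^{\mathrm{o}}$ of the isotropy group bundle is closed in $\Gamma(E^\infty,\sigma)$ if and only if $B^n$ is closed in $E^n$ for all $n\ge 1$.
   Context: All topological spaces are assumed second countable. Topological graphs. A topological graph $E=(E^0,E^1,r,s)$ consists of locally compact Hausdorff spaces $E^0,E^1$, a continuous map $r:E^1\to E^0$ and a local homeomorphism $s:E^1\to E^0$. Put $E^0_{\mathrm{fin}}=\{v\in E^0: v$ has an open neighborhood $N$ with $r^{-1}(\overline N)$ compact$\}$, $E^0_{\mathrm{sce}}=E^0\setminus\overline{r(E^1)}$, $E^0_{\mathrm{rg}}=E^0_{\mathrm{fin}}\setminus\overline{E^0_{\mathrm{sce}}}$, and $E^0_{\mathrm{sg}}=E^0\setminus E^0_{\mathrm{rg}}$ (singular vertices). Paths. For $n\ge1$, $E^n=\{(\mu_1,\dots,\mu_n)\in\prod_{i=1}^nE^1: s(\mu_i)=r(\mu_{i+1}),\ 1\le i<n\}$ with the subspace topology; for $\mu\in E^n$, $r(\mu)=r(\mu_1)$ and $s(\mu)=s(\mu_n)$. $E^\infty=\{x\in\prod_{i=1}^\infty E^1: s(x_i)=r(x_{i+1})$ for all $i\ge 1\}$ with the subspace topology of the product topology; if $E^0_{\mathrm{sg}}=\varnothing$ it is locally compact Hausdorff and the shift $\sigma(x_1x_2\cdots)=x_2x_3\cdots$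 is a local homeomorphism of $E^\infty$. Boundary path groupoid (for $E^0_{\mathrm{sg}}=\varnothing$). $\Gamma(E^\infty,\sigma)=\{(x,k-\ell,y)\in E^\infty\times\mathbb Z\times E^\infty: k,\ell\ge0,\ \sigma^k(x)=\sigma^\ell(y)\}$, with range $x$, source $y$, composition $(x,m,y)(y,m',z)=(x,m+m',z)$ and inverse $(x,m,y)^{-1}=(y,-m,x)$. Its topology has as base the sets $\mathcal U(U,V,k,\ell)=\{(x,k-\ell,y): x\in U,\ y\in V,\ \sigma^k(x)=\sigma^\ell(y)\}$ with $U,V\subset E^\infty$ open, $\sigma^k$ injective on $U$ and $\sigma^\ell$ injective on $V$. It is a locally compact Hausdorff étale groupoid. The isotropy group bundle is $\mathrm{Iso}(\Gamma(E^\infty,\sigma))=\{(x,m,x)\in\Gamma(E^\infty,\sigma)\}$, and $\mathrm{Iso}(\Gamma(E^\infty,\sigma))^{\mathrm{o}}$ is its interior in $\Gamma(E^\infty,\sigma)$. Cycles and $B^n$. A cycle in $E^n$ ($n\ge1$) is $\mu\in E^n$ with $r(\mu)=s(\mu)$; this common vertex is its base point. An entrance to $\mu$ is an edge $e\in E^1$ such that for some $i$, $r(e)=r(\mu_i)$ and $e\ne\mu_i$. For an open set $N\subset E^n$ and $k\ge1$, $kN$ denotes the set of paths in $E^{kn}$ that are concatenations of $k$ elements of $N$. For $n\ge1$, $B^n$ is the set of cycles $\mu\in E^n$ for which there exist $k\ge1$ and an open neighborhood $N$ of $\mu$ in $E^n$ such that (1) for any distinct $\alpha,\beta\in kN$ there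 is no path in $N$ connecting $s(\alpha)$ and $s(\beta)$, i.e. no $\gamma\in N$ with $r(\gamma)=s(\alpha)$ and $s(\gamma)=s(\beta)$; and (2) for any $\alpha\in kN$ there is no cycle belonging to $N$ that has an entrance and has base point $s(\alpha)$. *)

(* Defs.v *)
From HB Require Import structures.
From mathcomp Require Import all_boot all_order all_algebra.
From mathcomp Require Import zify.
From mathcomp Require Import all_classical all_reals topology.

Set Implicit Arguments.
Unset Strict Implicit.
Unset Printing Implicit Defensive.

Import Order.TTheory GRing.Theory Num.Theory.

Local Open Scope classical_set_scope.

(* The homeomorphism f : U -> f @` U is given together with its inverse g;
   values of g outside f @` U are irrelevant. *)
Definition local_homeomorphism (X Y : topologicalType) (f : X -> Y) :=
  forall x, exists U : set X, [/\ open_nbhs x U, open (f @` U) &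
    exists g : Y -> X, [/\ {in U, cancel f g},
      {within U, continuous f} & {within f @` U, continuous g}]].

Record topological_graph := TopologicalGraph {
  vertex : topologicalType;
  edge : topologicalType;
  rng : edge -> vertex;
  src : edge -> vertex;
  vertex_lc : locally_compact [set: vertex];
  vertex_hausdorff : hausdorff_space vertex;
  vertex_sc : @second_countable vertex;
  edge_lc : locally_compact [set: edge];
  edge_hausdorff : hausdorff_space edge;
  edge_sc : @second_countable edge;
  rng_continuous : continuous rng;
  src_local_homeo : local_homeomorphism src }.

Arguments rng {t} _.
Arguments src {t} _.

Definition fin_vertices (E : topological_graph) : set (vertex E) :=
  [set v | exists2 N, open_nbhs v N & compact (@rng E @^-1` closure N)].
Arguments fin_vertices : clear implicits.

Definition sce_vertices (E : topological_graph) : set (vertex E) :=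
  ~` closure (range (@rng E)).
Arguments sce_vertices : clear implicits.

Definition rg_vertices (E : topological_graph) : set (vertex E) :=
  fin_vertices E `\` closure (sce_vertices E).
Arguments rg_vertices : clear implicits.

Definition sg_vertices (E : topological_graph) : set (vertex E) :=
  ~` rg_vertices E.
Arguments sg_vertices : clear implicits.

(* Coerced to a type, a set carries the subspace topology, here of the product
   topology. Positions are numbered from 0: mu_1 is mu at index 0. *)
Definition path_set (E : topological_graph) (n : nat) :
    set {ptws 'I_n -> edge E} :=
  [set mu | forall i j : 'I_n, j = i.+1 :> nat -> src (mu i) = rng (mu j)].
Arguments path_set : clear implicits.

Definition fpath (E : topological_graph) (n : nat) : topologicalType :=
  set_type (path_set E n).

Definition fpath_edge (E : topological_graph) (n : nat) (mu : fpath E n)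
  (i : 'I_n) : edge E := set_val mu i.

Definition path_rng (E : topological_graph) (n : nat) (n_gt0 : (0 < n)%N)
  (mu : fpath E n) : vertex E := rng (fpath_edge mu (Ordinal n_gt0)).

(* rev_ord (Ordinal n_gt0) has value n.-1. *)
Definition path_src (E : topological_graph) (n : nat) (n_gt0 : (0 < n)%N)
  (mu : fpath E n) : vertex E := src (fpath_edge mu (rev_ord (Ordinal n_gt0))).

Definition is_cycle (E : topological_graph) (n : nat) (n_gt0 : (0 < n)%N)
  (mu : fpath E n) := path_rng n_gt0 mu = path_src n_gt0 mu.

Definition entrance (E : topological_graph) (n : nat) (mu : fpath E n)
  (e : edge E) :=
  exists i, rng e = rng (fpath_edge mu i) /\ e <> fpath_edge mu i.

Definition concatenations (E : topological_graph) (n k : nat)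
    (N : set (fpath E n)) : set (fpath E (k * n)) :=
  [set alpha | exists nu : 'I_k -> fpath E n, (forall i, N (nu i)) /\
    forall (i : 'I_k) (j : 'I_n) (l : 'I_(k * n)), l = (i * n + j)%N :> nat ->
      fpath_edge alpha l = fpath_edge (nu i) j].
Arguments concatenations {E n} k N.

Definition muln_pos (k n : nat) (k_gt0 : (0 < k)%N) (n_gt0 : (0 < n)%N) :
    (0 < k * n)%N :=
  etrans (muln_gt0 k n) (introT andP (conj k_gt0 n_gt0)).

Definition Bn (E : topological_graph) (n : nat) (n_gt0 : (0 < n)%N) :
    set (fpath E n) :=
  [set mu | is_cycle n_gt0 mu /\
    exists (k : nat) (k_gt0 : (0 < k)%N) (N : set (fpath E n)),
    let s_kN := @path_src E _ (muln_pos k_gt0 n_gt0) in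
    [/\ open_nbhs mu N,
      forall alpha beta, concatenations k N alpha -> concatenations k N beta ->
        alpha <> beta ->
        ~ exists gamma, [/\ N gamma, path_rng n_gt0 gamma = s_kN alpha &
            path_src n_gt0 gamma = s_kN beta] &
      forall alpha, concatenations k N alpha ->
        ~ exists gamma, [/\ N gamma, is_cycle n_gt0 gamma,
            exists e, entrance gamma e &
            path_rng n_gt0 gamma = s_kN alpha]]].

Definition infpath_set (E : topological_graph) : set {ptws nat -> edge E} :=
  [set x | forall i, src (x i) = rng (x i.+1)].
Arguments infpath_set : clear implicits.

Definition infpath (E : topological_graph) : topologicalType :=
  set_type (infpath_set E).

Definition infpath_edge (E : topological_graph) (x : infpath E) (i : nat) :
  edge E := set_val x i.

Lemma shift_subproof (E : topological_graph) (x : infpath E) :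
  (fun i => infpath_edge x i.+1) \in infpath_set E.
Proof. by apply: mem_set => i; exact: (set_valP x). Qed.

Definition shift (E : topological_graph) (x : infpath E) : infpath E :=
  exist _ (fun i => infpath_edge x i.+1) (shift_subproof x).

Lemma infpath_edge_continuous (E : topological_graph) (i : nat) :
  continuous (fun x : infpath E => infpath_edge x i).
Proof.
move=> x; apply: (@continuous_comp (infpath E) {ptws nat -> edge E} (edge E)
  set_val (proj i) x); first exact: initial_continuous.
exact: (@proj_continuous nat (fun=> edge E) i).
Qed.

Lemma shift_continuous (E : topological_graph) : continuous (@shift E).
Proof.
apply: continuous_comp_initial => x.
apply/cvg_sup; first exact/fmap_filter/(nbhs_filter x).
move=> i; move: x; apply/(@continuousP _ (initial_topology (@^~ i))).
move=> _ [A oA <-].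
have /continuousP/(_ A oA) := @infpath_edge_continuous E i.+1.
exact.
Qed.

Lemma iter_shift_locally_injective (E : topological_graph) (k : nat)
    (x : infpath E) :
  exists2 U, open_nbhs x U & {in U &, injective (iter k (@shift E))}.
Proof.
elim: k x => [|k IHk] x; first by exists setT => //; exact: open_nbhsT.
have [V [oV Vx] Vinj] := IHk (shift x).
have [W [[oW Wx] _ [g [gK _ _]]]] :=
  @src_local_homeo E (infpath_edge x 0).
exists ((fun x => infpath_edge x 0) @^-1` W `&` @shift E @^-1` V).
  split; last by split.
  apply: openI; first by move/continuousP : (@infpath_edge_continuous E 0); exact.
  by move/continuousP : (@shift_continuous E); exact.
move=> y z /set_mem[Wy Vy] /set_mem[Wz Vz]; rewrite !iterSr => /Vinj yz.
have {}yz : shift y = shift z by apply: yz; exact: mem_set.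
have yzS i : infpath_edge y i.+1 = infpath_edge z i.+1.
  by have := congr1 (fun x : infpath E => infpath_edge x i) yz.
apply/val_inj/funext => -[|i]; last exact: yzS.
apply: (can_in_inj gK); try exact: mem_set.
by rewrite (set_valP y 0%N) (set_valP z 0%N); congr rng; exact: yzS.
Qed.

Definition groupoid_set (E : topological_graph) :
    set (infpath E * int * infpath E) :=
  [set g | exists k l : nat, g.1.2 = (k%:Z - l%:Z)%R /\
    iter k (@shift E) g.1.1 = iter l (@shift E) g.2].
Arguments groupoid_set : clear implicits.

(* The topology of the groupoid is not the subspace topology inherited from the
   product; it is generated by the sets groupoid_base below. *)
Definition groupoid (E : topological_graph) : Type :=
  set_type (groupoid_set E).

HB.instance Definition _ (E : topological_graph) :=
  Choice.copy (groupoid E) (set_type (groupoid_set E)).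

Definition grange (E : topological_graph) (g : groupoid E) : infpath E :=
  (val g).1.1.

Definition gdegree (E : topological_graph) (g : groupoid E) : int :=
  (val g).1.2.

Definition gsource (E : topological_graph) (g : groupoid E) : infpath E :=
  (val g).2.

Lemma ginv_subproof (E : topological_graph) (g : groupoid E) :
  (gsource g, (- gdegree g)%R, grange g) \in groupoid_set E.
Proof.
have [k [l [gkl klg]]] := set_valP g.
by apply: mem_set; exists l, k; split=> //=; rewrite /gdegree gkl opprB.
Qed.

Definition ginv (E : topological_graph) (g : groupoid E) : groupoid E :=
  exist _ (gsource g, (- gdegree g)%R, grange g) (ginv_subproof g).

Lemma gcomp_subproof (E : topological_graph) (g h : groupoid E) :
  gsource g = grange h ->
  (grange g, (gdegree g + gdegree h)%R, gsource h) \in groupoid_set E.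
Proof.
have [k [l [gkl klg]]] := set_valP g; have [k' [l' [hkl klh]]] := set_valP h.
move=> gh; apply: mem_set; exists (k' + k)%N, (l + l')%N; split=> /=.
  by rewrite /gdegree gkl hkl; lia.
rewrite !iterD [iter k _ _]klg -[iter l' _ _]klh -!iterD addnC.
by rewrite -[(val g).2]/(gsource g) gh.
Qed.

Definition gcomp (E : topological_graph) (g h : groupoid E)
    (gh : gsource g = grange h) : groupoid E :=
  exist _ (grange g, (gdegree g + gdegree h)%R, gsource h) (gcomp_subproof gh).

Definition groupoid_base (E : topological_graph)
    (i : set (infpath E) * set (infpath E) * (nat * nat)) :
    set (groupoid E) :=
  let: (U, V, (k, l)) := i in
  [set g | [/\ U (grange g), V (gsource g), gdegree g = (k%:Z - l%:Z)%R &
    iter k (@shift E) (grange g) = iter l (@shift E) (gsource g)]].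

Definition groupoid_base_dom (E : topological_graph) :
    set (set (infpath E) * set (infpath E) * (nat * nat)) :=
  [set i | let: (U, V, (k, l)) := i in
    [/\ open U, open V, {in U &, injective (iter k (@shift E))} &
      {in V &, injective (iter l (@shift E))}]].
Arguments groupoid_base_dom : clear implicits.

Lemma groupoid_base_cover (E : topological_graph) :
  \bigcup_(i in groupoid_base_dom E) groupoid_base i = setT.
Proof.
rewrite predeqE => g; split=> // _.
have [k [l [gkl klg]]] := set_valP g.
have [U [oU Ug] Uinj] := iter_shift_locally_injective k (grange g).
have [V [oV Vg] Vinj] := iter_shift_locally_injective l (gsource g).
by exists (U, V, (k, l)); split.
Qed.

Lemma groupoid_base_join (E : topological_graph)
    (i j : set (infpath E) * set (infpath E) * (nat * nat)) (t : groupoid E) :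
  groupoid_base_dom E i -> groupoid_base_dom E j ->
  groupoid_base i t -> groupoid_base j t ->
  exists k, [/\ groupoid_base_dom E k, groupoid_base k t &
    groupoid_base k `<=` groupoid_base i `&` groupoid_base j].
Proof.
wlog : i j / (i.2.1 <= j.2.1)%N => [wlog_le|].
  case: (leqP i.2.1 j.2.1) => [|/ltnW] ij Di Dj ti tj; first exact: wlog_le.
  by rewrite setIC; exact: wlog_le.
move: i j => [[U V] [k l]] [[U' V'] [k' l']] /= kk'.
move=> [oU oV Uinj Vinj] [oU' oV' _ _] [Ut Vt tkl klt] [U't V't tkl' _].
have [p k'E l'E] : exists2 p, k' = (p + k)%N & l' = (p + l)%N.
  by exists (k' - k)%N; move: tkl'; rewrite tkl; lia.
exists (U `&` U', V `&` V', (k, l)); split => //=.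
- split; [exact: openI|exact: openI|..].
  + by move=> x y /set_mem[Ux _] /set_mem[Uy _]; apply: Uinj; exact: mem_set.
  + by move=> x y /set_mem[Vx _] /set_mem[Vy _]; apply: Vinj; exact: mem_set.
- move=> g [[Ug U'g] [Vg V'g] gkl klg]; split; split => //.
  + by rewrite gkl -tkl tkl'.
  + by rewrite k'E l'E !iterD klg.
Qed.

HB.instance Definition _ (E : topological_graph) :=
  @isBaseTopological.Build (groupoid E)
    (set (infpath E) * set (infpath E) * (nat * nat))%type
    (groupoid_base_dom E) (@groupoid_base E)
    (@groupoid_base_cover E) (@groupoid_base_join E).

Definition Iso (E : topological_graph) : set (groupoid E) :=
  [set g | grange g = gsource g].
Arguments Iso : clear implicits.

(* Main.v *)
Require Import Defs.
From mathcomp Require Import all_boot all_order all_algebra.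
From mathcomp Require Import zify.
From mathcomp Require Import all_classical all_reals topology.

(* Some imports above define another shift; this makes shift mean sigma. *)
Require Import Defs.

Set Implicit Arguments.
Unset Strict Implicit.
Unset Printing Implicit Defensive.

Import GRing.Theory.

Local Open Scope classical_set_scope.

(** Both sides of the equivalence speak of the sets Fix(sigma^n) of n-periodic
infinite paths: each of them says that, for every n > 0, the interior of
Fix(sigma^n) is closed in the space of infinite paths.

On the groupoid side ([closed_interior_IsoP]), an isotropy element (x, m, x) is
interior exactly when sigma^k = sigma^l on a neighbourhood of x for some k, l
with k - l = m ([interior_IsoP]): a basic open set around it consists of pairs
with sigma^k y = sigma^l z, and every y near x occurs in such a pair because
sigma is an open map. Up to inversion m = n > 0, since elements of degree 0
are always interior. Applying sigma^l moves x to an n-periodic path, and near a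
periodic path a local identity sigma^(l+n) = sigma^l can be pushed forward along
a multiple of n until it reads sigma^n = id ([nbhs_periodic_iter_shift]). So limits of
interior isotropy correspond to limits of interior points of Fix(sigma^n).

On the graph side ([closed_BnP]), cycles mu of length n correspond to n-periodic
paths mu mu mu ..., and mu lies in B^n exactly when this path is interior to
Fix(sigma^n). If mu is in B^n, with k and N as in the definition, let y begin
with k+1 blocks of length n taken from N. Its first k blocks and its blocks
2, ..., k+1 are elements of kN joined by block k+1, so they coincide; thus the
first k+1 blocks are one and the same cycle, this cycle has no entrance, and y
can only go on repeating it ([Bn_nbhs_periodic]). Conversely, if every path with
its first k blocks in N is periodic, then a connection between different
elements of kN, or an entrance to a cycle, would allow one to continue an
element of kN non-periodically ([nbhs_periodic_Bn]). Such continuations exist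
because the absence of singular vertices makes r surjective ([rng_surjective]):
r is proper, so its image is closed, and it is dense. *)

(** * Infinite paths and the shift *)

Section InfinitePaths.
Context {E : topological_graph}.
Implicit Types (x y z : infpath E).

Lemma infpath_ext x y : (forall i, infpath_edge x i = infpath_edge y i) -> x = y.
Proof. by move=> xy; apply/val_inj/funext. Qed.

Lemma fpath_ext n (mu nu : fpath E n) :
  (forall i, fpath_edge mu i = fpath_edge nu i) -> mu = nu.
Proof. by move=> mn; apply/val_inj/funext. Qed.

Lemma infpath_edgeS x i : src (infpath_edge x i) = rng (infpath_edge x i.+1).
Proof. exact: (set_valP x). Qed.

Lemma infpath_of_edges (c : nat -> edge E) :
  (forall i, src (c i) = rng (c i.+1)) ->
  exists x, forall i, infpath_edge x i = c i.
Proof.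
by move=> cP; exists (exist _ (c : {ptws nat -> edge E}) (mem_set cP : c \in infpath_set E)).
Qed.

Lemma iter_shiftE n x i :
  infpath_edge (iter n (@shift E) x) i = infpath_edge x (n + i).
Proof.
elim: n i => [//|n IHn] i; rewrite iterS.
by rewrite -[LHS]/(infpath_edge (iter n (@shift E) x) i.+1) IHn addnS.
Qed.

Lemma nbhs_iter_shift n x (A : set (infpath E)) :
  nbhs (iter n (@shift E) x) A -> nbhs x (iter n (@shift E) @^-1` A).
Proof.
elim: n A => [//|n IHn] A /(@shift_continuous E)/IHn.
exact.
Qed.

(** The product topology is the coarsest one refining the topologies pulled back
along the coordinates, so it suffices to check that the filter generated by the
cylinders around x is finer than each of these. *)
Lemma infpath_nbhs_cylinder x (A : set (infpath E)) : nbhs x A ->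
  exists (m : nat) (U : nat -> set (edge E)),
    (forall i, nbhs (infpath_edge x i) (U i)) /\
    forall y, (forall i, (i < m)%N -> U i (infpath_edge y i)) -> A y.
Proof.
rewrite nbhsE => -[B [[C oC CB] Bx] BA].
have Cx : nbhs (set_val x : {ptws nat -> edge E}) C.
  by apply: open_nbhs_nbhs; split=> //; rewrite -CB in Bx.
pose D := [set c : nat * (nat -> set (edge E)) |
  forall i, nbhs (infpath_edge x i) (c.2 i)].
pose b (c : nat * (nat -> set (edge E))) :=
  [set y : {ptws nat -> edge E} | forall i, (i < c.1)%N -> c.2 i (y i)].
have FF : Filter (filter_from D b).
  apply: filter_from_filter; first by exists (0%N, fun=> setT) => i; exact: filterT.
  move=> [m U] [m' U'] DU DU'; exists (maxn m m', fun i => U i `&` U' i).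
    by move=> i; apply: filterI; [exact: DU|exact: DU'].
  by move=> y yU; split=> i /= im; apply yU; rewrite /=; lia.
have : filter_from D b --> (set_val x : {ptws nat -> edge E}).
  apply/cvg_sup => i V; rewrite nbhsE => -[W [[Q oQ QW] Wx] WV].
  exists (i.+1, fun j => if j == i then Q else setT).
    move=> j /=; case: eqP => [->|_]; last exact: filterT.
    by apply: open_nbhs_nbhs; split=> //; rewrite -QW in Wx.
  by move=> y /(_ i (ltnSn i)) /=; rewrite eqxx => Qy; apply: WV; rewrite -QW.
move=> /(_ C Cx)[[m U] DU UC]; exists m, U; split=> // y yU.
by apply: BA; rewrite -CB; exact: UC.
Qed.

Lemma cylinder_nbhs x m (U : nat -> set (edge E)) :
  (forall i, nbhs (infpath_edge x i) (U i)) ->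
  nbhs x [set y | forall i, (i < m)%N -> U i (infpath_edge y i)].
Proof.
move=> Ux.
have : \forall y \near x, forall i : 'I_m, U i (infpath_edge y i).
  apply: (@filter_forall _ _ _ _ (nbhs_filter x)) => i.
  by apply: (@infpath_edge_continuous E i x); exact: Ux.
by apply: filterS => y Uy i im; exact: (Uy (Ordinal im)).
Qed.

Lemma infpath_hausdorff : hausdorff_space (infpath E).
Proof.
move=> x y xy; apply: infpath_ext => i; apply: (@edge_hausdorff E) => A B Ax By.
have [z [Az Bz]] := xy _ _ (@infpath_edge_continuous E i x _ Ax)
  (@infpath_edge_continuous E i y _ By).
by exists (infpath_edge z i).
Qed.

Lemma infpath_glue m (a : nat -> edge E) y :
  (forall i, (i.+1 < m)%N -> src (a i) = rng (a i.+1)) ->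
  (forall i, i.+1 = m -> src (a i) = rng (infpath_edge y 0)) ->
  exists2 z, (forall i, (i < m)%N -> infpath_edge z i = a i) &
    iter m (@shift E) z = y.
Proof.
move=> aP ay.
pose c i := if (i < m)%N then a i else infpath_edge y (i - m).
have [|z zc] := @infpath_of_edges c.
  move=> i; rewrite /c.
  have [im|im] := ltnP i.+1 m; first by rewrite ltnW // aP.
  have [im'|im'] := ltnP i m.
    have mE : i.+1 = m by apply/eqP; rewrite eqn_leq im' im.
    by rewrite (ay i mE) mE subnn.
  by rewrite infpath_edgeS subSn.
exists z; first by move=> i im; rewrite zc /c im.
by apply: infpath_ext => i; rewrite iter_shiftE zc /c ltnNge leq_addr /= addKn.
Qed.

Lemma src_continuous : continuous (@src E).
Proof.
move=> e; have [U [[oU Ue] _ [_ [_ sc _]]]] := @src_local_homeo E e.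
move: sc; rewrite continuous_open_subspace //; apply; exact: mem_set.
Qed.

Lemma src_open e (A : set (edge E)) : nbhs e A -> nbhs (src e) (src @` A).
Proof.
move=> Ae; have [U [[oU Ue] sU [g [gK _ gc]]]] := @src_local_homeo E e.
have sUe : (src @` U) (src e) by exists e.
have ge : g (src e) = e by apply: gK; exact: mem_set.
move: gc; rewrite continuous_open_subspace // => /(_ _ (mem_set sUe)) gc.
have gA : nbhs (g (src e)) A by rewrite ge.
have sUn : nbhs (src e) (src @` U) by exact: open_nbhs_nbhs.
apply: filterS (filterI (gc _ gA : nbhs (src e) (g @^-1` A)) sUn).
move=> v [Ag [u Uu uv]]; exists u => //.
by move: Ag; rewrite /= -uv gK //; exact: mem_set.
Qed.

(** A path y is the shift of a path in a cylinder with sides U 0, U 1, ... as soon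
as an edge of U 0 ends where y starts; this is an open condition on y because
src is open. *)
Lemma shift_open x (A : set (infpath E)) :
  nbhs x A -> nbhs (shift x) (@shift E @` A).
Proof.
move=> /infpath_nbhs_cylinder[m [U [Ux UA]]].
have nU : nbhs (shift x) [set y | forall i, (i < m)%N -> U i.+1 (infpath_edge y i)].
  exact: (@cylinder_nbhs (shift x) m (fun i => U i.+1) (fun i => Ux i.+1)).
have n0 : nbhs (shift x) [set y | (src @` U 0%N) (rng (infpath_edge y 0))].
  have n1 : nbhs (rng (infpath_edge (shift x) 0)) (src @` U 0%N).
    by rewrite -[infpath_edge _ 0]/(infpath_edge x 1) -infpath_edgeS; exact: src_open.
  exact: (@infpath_edge_continuous E 0 (shift x) _ (@rng_continuous E _ _ n1)).
apply: filterS (filterI n0 nU) => y [[e U0e ey] Uy].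
have [//|i _|z ze zy] := @infpath_glue 1 (fun=> e) y; first exact: ey.
exists z => //; apply: UA => -[|i] im; first by rewrite ze.
have -> : infpath_edge z i.+1 = infpath_edge (shift z) i by [].
by rewrite -[shift z]/(iter 1 (@shift E) z) zy; apply: Uy; exact: ltnW.
Qed.

Lemma iter_shift_open n x (A : set (infpath E)) :
  nbhs x A -> nbhs (iter n (@shift E) x) (iter n (@shift E) @` A).
Proof.
move=> Ax; elim: n => [|n /shift_open] /=; first by rewrite image_id.
by rewrite -image_comp.
Qed.

(** * Finite segments of infinite paths *)

Lemma segment_subproof x m n :
  (fun i : 'I_n => infpath_edge x (m + i)) \in path_set E n.
Proof. by apply: mem_set => i j ->; rewrite infpath_edgeS addnS. Qed.

Definition segment m n x : fpath E n :=
  exist _ (fun i : 'I_n => infpath_edge x (m + i)) (segment_subproof x m n).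

Lemma segmentE m n x (i : 'I_n) :
  fpath_edge (segment m n x) i = infpath_edge x (m + i).
Proof. by []. Qed.

Lemma segment_iter m n x : segment m n x = segment 0 n (iter m (@shift E) x).
Proof. by apply: fpath_ext => i; rewrite !segmentE iter_shiftE. Qed.

Lemma path_rng_segment m n (n_gt0 : (0 < n)%N) x :
  path_rng n_gt0 (segment m n x) = rng (infpath_edge x m).
Proof. by rewrite /path_rng segmentE addn0. Qed.

Lemma path_src_segment m n (n_gt0 : (0 < n)%N) x :
  path_src n_gt0 (segment m n x) = rng (infpath_edge x (m + n)).
Proof.
rewrite /path_src segmentE infpath_edgeS; congr (rng (infpath_edge x _)).
by rewrite /=; lia.
Qed.

Lemma fpath_edge_continuous n (i : 'I_n) :
  continuous (fun mu : fpath E n => fpath_edge mu i).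
Proof.
move=> mu; apply: (@continuous_comp (fpath E n) {ptws 'I_n -> edge E} (edge E)
  set_val (proj i) mu); first exact: initial_continuous.
exact: (@proj_continuous 'I_n (fun=> edge E) i).
Qed.

Lemma segment_continuous m n : continuous (segment m n).
Proof.
apply: continuous_comp_initial => x.
apply/cvg_sup; first exact/fmap_filter/(nbhs_filter x).
move=> i; move: x; apply/(@continuousP _ (initial_topology (@^~ i))).
move=> _ [A oA <-].
by have /continuousP/(_ A oA) := @infpath_edge_continuous E (m + i)%N; exact.
Qed.

Lemma prepend n (n_gt0 : (0 < n)%N) (mu : fpath E n) y :
  path_src n_gt0 mu = rng (infpath_edge y 0) ->
  exists2 z, segment 0 n z = mu & iter n (@shift E) z = y.
Proof.
move=> muy.
pose a i := fpath_edge mu (Ordinal (ltn_pmod i n_gt0)).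
have [i im|i im|z za zy] := @infpath_glue n a y.
- by apply: (set_valP mu) => /=; rewrite !modn_small // ltnW.
- rewrite -muy; congr (src (fpath_edge mu _)).
  by apply: val_inj; rewrite /= modn_small; lia.
exists z => //; apply: fpath_ext => i; rewrite segmentE add0n za //.
by congr (fpath_edge mu _); apply: val_inj; rewrite /= modn_small.
Qed.

(** * Periodic paths *)

Definition periodic n : set (infpath E) := [set x | iter n (@shift E) x = x].

Lemma periodic_edge n x i : periodic n x -> infpath_edge x (n + i) = infpath_edge x i.
Proof. by rewrite -iter_shiftE => ->. Qed.

Lemma periodic_muln k n x : periodic n x -> periodic (k * n) x.
Proof. by move=> xn; elim: k => [//|k IHk]; rewrite /periodic/= mulSn iterD IHk. Qed.

Lemma periodic_segment m k n x : periodic n x ->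
  segment (k * n) m x = segment 0 m x.
Proof. by move=> /(periodic_muln k) xn; rewrite segment_iter xn. Qed.

Lemma periodic_is_cycle n (n_gt0 : (0 < n)%N) x :
  periodic n x -> is_cycle n_gt0 (segment 0 n x).
Proof.
move=> xn; rewrite /is_cycle path_rng_segment path_src_segment add0n.
by rewrite -[n in RHS]addn0 periodic_edge.
Qed.

(** The path in question repeats mu forever. *)
Lemma cycle_periodic n (n_gt0 : (0 < n)%N) (mu : fpath E n) :
  is_cycle n_gt0 mu -> exists2 x, periodic n x & segment 0 n x = mu.
Proof.
move=> cyc; pose a i := fpath_edge mu (Ordinal (ltn_pmod i n_gt0)).
have [|x xa] := @infpath_of_edges a.
  move=> i; have [im|im] := ltnP (i %% n).+1 n.
    apply: (set_valP mu) => /=.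
    by rewrite -addn1 -modnDml addn1 modn_small.
  have iE : (i %% n).+1 = n by apply/eqP; rewrite eqn_leq im ltn_pmod.
  transitivity (path_src n_gt0 mu).
    by congr (src (fpath_edge mu _)); apply: val_inj => /=; lia.
  rewrite -cyc; congr (rng (fpath_edge mu _)); apply: val_inj => /=.
  by rewrite -addn1 -modnDml addn1 iE modnn.
exists x.
  apply: infpath_ext => i; rewrite iter_shiftE !xa; congr (fpath_edge mu _).
  by apply: val_inj; rewrite /= modnDl.
apply: fpath_ext => i; rewrite segmentE add0n xa.
congr (fpath_edge mu _).
by apply: val_inj; rewrite /= modn_small.
Qed.

Lemma closure_periodic n : closure (periodic n) `<=` periodic n.
Proof.
move=> x xn; apply: infpath_hausdorff => A B Ax Bx.
have [y [yn [Ay By]]] := xn _ (filterI (nbhs_iter_shift Ax) Bx).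
by exists y; split=> //; rewrite -yn.
Qed.

(** The path sigma^k x is n-periodic, so it is also sigma^(l n + k) x, and
sigma^n = id on the image under sigma^(l n + k) of the neighbourhood where
sigma^(l+n) = sigma^l, because l n + k >= l. That image is a neighbourhood, the
shift being open. *)
Lemma nbhs_periodic_iter_shift n k l x : (0 < n)%N ->
  iter (k + n) (@shift E) x = iter k (@shift E) x ->
  nbhs x [set y | iter (l + n) (@shift E) y = iter l (@shift E) y] ->
  nbhs (iter k (@shift E) x) (periodic n).
Proof.
move=> n_gt0 xk Ax.
have <- : iter (l * n + k) (@shift E) x = iter k (@shift E) x.
  by rewrite iterD; apply: periodic_muln; rewrite /periodic /= -iterD addnC.
apply: filterS (iter_shift_open (l * n + k) Ax) => _ [y /= yl <-].
rewrite /periodic /= -iterD.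
have [p ->] : exists p, (l * n + k = p + l)%N.
  exists (l * n + k - l)%N; rewrite subnK //.
  by rewrite (leq_trans (leq_pmulr l n_gt0)) ?leq_addr.
by rewrite addnCA iterD [(n + l)%N]addnC yl -iterD.
Qed.

End InfinitePaths.

(** * Existence of infinite paths *)

(** Every vertex v has a neighbourhood N such that r maps the compact set
r^-1(closure N) onto a closed set, and the image of r is dense in N. *)
Lemma rng_surjective (E : topological_graph) (v : vertex E) :
  sg_vertices E = set0 -> exists e, rng e = v.
Proof.
move=> hE; have rg w : rg_vertices E w.
  by apply: contrapT => nw; have : set0 w by rewrite -hE.
have dense w : closure (range (@rng E)) w.
  by apply: contrapT => nw; have [_] := rg w; apply; exact: subset_closure.
have [[N [oN Nv] cK] _] := rg v.
suff [e _ <-] : (rng @` (@rng E @^-1` closure N)) v by exists e.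
have /compact_closed : compact (rng @` (@rng E @^-1` closure N)).
  apply: continuous_compact => //; apply: continuous_subspaceT.
  exact: rng_continuous.
move=> /(_ (@vertex_hausdorff E)); apply => B Bv.
have [_ [[e _ <-] [Be Ne]]] := dense v _ (filterI Bv (open_nbhs_nbhs (conj oN Nv))).
by exists (rng e); split=> //; exists e => //; exact: subset_closure.
Qed.

Lemma infpath_from (E : topological_graph) : sg_vertices E = set0 ->
  forall v : vertex E, exists x : infpath E, rng (infpath_edge x 0) = v.
Proof.
move=> hE v; have [f fK] := choice (fun w : vertex E => rng_surjective w hE).
pose a := fix a i := if i is i'.+1 then f (src (a i')) else f v.
have [|x xa] := @infpath_of_edges E a; first by move=> i /=; rewrite fK.
by exists x; rewrite xa fK.
Qed.

(** * Cycles and periodic paths *)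

Section CyclesAndPeriodicPaths.
Context {E : topological_graph}.
Context (n : nat) (n_gt0 : (0 < n)%N).
Implicit Types (x y z : infpath E) (N : set (fpath E n)).

(** A cylinder around a periodic path restricts, position by position modulo n,
only finitely many conditions on a block; N imposes all of them at once, so that
it can serve for every block. *)
Lemma periodic_nbhs_blocks x (A : set (infpath E)) :
  periodic n x -> nbhs x A ->
  exists (k : nat) (N : set (fpath E n)), [/\ (0 < k)%N,
    open_nbhs (segment 0 n x) N &
    forall y, (forall j, (j < k)%N -> N (segment (j * n) n y)) -> A y].
Proof.
move=> xn /infpath_nbhs_cylinder[m [U [Ux UA]]].
pose N := [set nu : fpath E n |
  forall (i : 'I_n) (j : 'I_m.+1), U (j * n + i)%N (fpath_edge nu i)].
have Nx : \forall nu \near segment 0 n x,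
    forall (i : 'I_n) (j : 'I_m.+1), U (j * n + i)%N (fpath_edge nu i).
  apply: (@filter_forall _ _ _ _ (nbhs_filter (segment 0 n x))) => i.
  apply: (@filter_forall _ _ _ _ (nbhs_filter (segment 0 n x))) => j.
  apply: (@fpath_edge_continuous E n i).
  rewrite segmentE add0n -[infpath_edge x i](periodic_edge _ (periodic_muln j xn)).
  exact: Ux.
exists m.+1, N°; split=> //.
  by split; [exact: open_interior|exact: nbhs_singleton (nbhs_interior Nx)].
move=> y yN; apply: UA => i im.
have jm : (i %/ n < m.+1)%N by rewrite ltnS (leq_trans (leq_div i n)) // ltnW.
have := interior_subset (yN _ jm) => /(_ (Ordinal (ltn_pmod i n_gt0)) (Ordinal jm)).
by rewrite segmentE /= -divn_eq.
Qed.

Lemma concatenations_segment k N x m :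
  (forall j, (j < k)%N -> N (segment (m + j * n) n x)) ->
  concatenations k N (segment m (k * n) x).
Proof.
move=> Nx; exists (fun j : 'I_k => segment (m + j * n) n x).
by split=> [j|i j l lE]; [exact: Nx|rewrite !segmentE lE addnA].
Qed.

Lemma concatenations_block k N x j : concatenations k N (segment 0 (k * n) x) ->
  (j < k)%N -> N (segment (j * n) n x).
Proof.
move=> [nu [Nnu nuE]] jk; suff -> : segment (j * n) n x = nu (Ordinal jk) by [].
apply: fpath_ext => i.
have il : (j * n + i < k * n)%N by have := ltn_ord i; nia.
by rewrite -(nuE _ i (Ordinal il)) // !segmentE.
Qed.

(** From each vertex of a cycle without entrance, a path can only follow that
cycle. *)
Lemma no_entrance_periodic y : rng (infpath_edge y 0) = rng (infpath_edge y n) ->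
  (forall e i, (i < n)%N -> rng e = rng (infpath_edge y i) -> e = infpath_edge y i) ->
  periodic n y.
Proof.
move=> cyc noent.
have ymod j : infpath_edge y j = infpath_edge y (j %% n).
  elim: j => [|j IHj]; first by rewrite mod0n.
  have [jn|jn] := ltnP (j %% n).+1 n.
    have -> : (j.+1 %% n = (j %% n).+1)%N by rewrite -addn1 -modnDml addn1 modn_small.
    by apply: noent => //; rewrite -!infpath_edgeS IHj.
  have jE : (j %% n).+1 = n by apply/eqP; rewrite eqn_leq jn ltn_pmod.
  have -> : (j.+1 %% n = 0)%N by rewrite -addn1 -modnDml addn1 jE modnn.
  by apply: noent => //; rewrite -infpath_edgeS IHj infpath_edgeS jE.
by apply: infpath_ext => i; rewrite iter_shiftE ymod modnDl -ymod.
Qed.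

(** The neighbourhood consists of the paths y whose first k+1 blocks are in N.
The first condition of B^n applies to the k blocks of y starting at position 0
and the k blocks starting at position n, and the second one to the block that
follows the first k. *)
Lemma Bn_nbhs_periodic x : periodic n x ->
  Bn n_gt0 (segment 0 n x) -> nbhs x (periodic n).
Proof.
move=> xn [_ [k [k_gt0 [N [oN conn ent]]]]].
have : \forall y \near x, forall j : 'I_k.+1, N (segment (j * n) n y).
  apply: (@filter_forall _ _ _ _ (nbhs_filter x)) => j; apply: (@segment_continuous E (j * n) n x).
  by rewrite periodic_segment //; exact: open_nbhs_nbhs.
apply: filterS => y Ny.
have {}Ny j : (j <= k)%N -> N (segment (j * n) n y).
  by rewrite -ltnS => jk; exact: (Ny (Ordinal jk)).
(* alpha and beta overlap in all blocks but one, so alpha = beta is periodicity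
   of y on its first k * n edges. *)
set alpha := segment 0 (k * n) y; set beta := segment n (k * n) y.
have Nalpha : concatenations k N alpha.
  by apply: concatenations_segment => j jk; rewrite add0n; apply: Ny; exact: ltnW.
have Nbeta : concatenations k N beta.
  by apply: concatenations_segment => j jk; rewrite -mulSn; exact: Ny.
have ab : alpha = beta.
  apply: contrapT => ab; apply: (conn _ _ Nalpha Nbeta ab).
  exists (segment (k * n) n y); split; first exact: Ny.
    by rewrite path_rng_segment path_src_segment.
  by rewrite !path_src_segment addnC.
have yn i : (i < k * n)%N -> infpath_edge y (n + i) = infpath_edge y i.
  by move=> ik; have := congr1 (fun mu => fpath_edge mu (Ordinal ik)) ab.
have cyc : rng (infpath_edge y (k * n)) = rng (infpath_edge y (k * n + n)).
  have := congr1 (path_src (muln_pos k_gt0 n_gt0)) ab.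
  by rewrite !path_src_segment add0n addnC.
have tail : periodic n (iter (k * n) (@shift E) y).
  apply: no_entrance_periodic; first by rewrite !iter_shiftE addn0.
  move=> e i ik; rewrite iter_shiftE => ei; apply: contrapT => nei.
  apply: (ent _ Nalpha); exists (segment (k * n) n y); split; first exact: Ny.
  - by rewrite /is_cycle path_rng_segment path_src_segment.
  - by exists e, (Ordinal ik); rewrite segmentE.
  - by rewrite path_rng_segment path_src_segment.
apply: infpath_ext => i; rewrite iter_shiftE; have [ik|ik] := ltnP i (k * n).
  exact: yn.
rewrite -(subnKC ik) addnCA -[LHS]iter_shiftE -[RHS]iter_shiftE.
exact: periodic_edge.
Qed.

(** Every continuation of an element of kN is periodic. If gamma connects alpha
to beta, then alpha gamma z and beta z are periodic, where z starts at the source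
of gamma; so z is periodic too, both paths equal z, and alpha = beta. If gamma is a cycle
based at the source of alpha with an entrance, then alpha gamma gamma ... can be
left through that entrance. *)
Lemma nbhs_periodic_Bn x : (forall v : vertex E, exists y, rng (infpath_edge y 0) = v) ->
  nbhs x (periodic n) -> Bn n_gt0 (segment 0 n x).
Proof.
move=> from Px; have xn : periodic n x := nbhs_singleton Px.
split; first exact: periodic_is_cycle.
have [k [N [k_gt0 oN NP]]] := periodic_nbhs_blocks xn Px.
(* A path of kN followed by any infinite path w is the n-periodic path w. *)
have ext alpha w : concatenations k N alpha ->
    path_src (muln_pos k_gt0 n_gt0) alpha = rng (infpath_edge w 0) ->
    periodic n w /\ segment 0 (k * n) w = alpha.
  move=> Nalpha /prepend[z za zw].
  suff zn : periodic n z by rewrite -zw periodic_muln.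
  by apply: NP => j; apply: concatenations_block; rewrite za.
exists k, k_gt0, N; split=> //.
  move=> alpha beta Nalpha Nbeta ab [gamma [Ngamma rg sg]].
  have [z zE] := from (path_src n_gt0 gamma).
  have [w wg wz] := prepend (esym zE).
  have [|wn wa] := ext alpha w Nalpha.
    by rewrite -rg -wg path_rng_segment.
  have [|zn zb] := ext beta z Nbeta; first by rewrite -sg zE.
  by apply: ab; rewrite -wa -zb -wz wn.
move=> alpha Nalpha [gamma [Ngamma cyc [e [i [ei nei]]] rg]].
have [z zn zg] := cycle_periodic cyc.
have [|_ za] := ext alpha z Nalpha; first by rewrite -rg -zg path_rng_segment.
have {}ei : rng e = rng (infpath_edge z i) by rewrite ei -zg segmentE.
(* w follows alpha gamma gamma ... up to position k * n + i and leaves it there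
   through e. *)
have [u ue] := from (src e).
have [//|j _|v ve vu] := @infpath_glue E 1 (fun=> e) u; first by rewrite ue.
have [j _|j jE|w wz wv] := @infpath_glue E (k * n + i) (infpath_edge z) v.
- exact: infpath_edgeS.
- by rewrite infpath_edgeS jE periodic_edge ?ve //; exact: periodic_muln.
have wn : periodic n w.
  apply: NP => j jk; apply: concatenations_block jk.
  suff -> : segment 0 (k * n) w = alpha by [].
  rewrite -za; apply: fpath_ext => l; rewrite !segmentE wz //.
  by rewrite (leq_trans (ltn_ord l)) ?leq_addr.
apply: nei; rewrite -zg segmentE add0n -wz; last by have := ltn_ord i; nia.
rewrite -(periodic_edge i (periodic_muln k wn)).
by rewrite -[(k * n + i)%N]addn0 -iter_shiftE wv ve.
Qed.

(** Membership in B^n agrees with interiority at corresponding points, so closures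
are compared: taking the first block is continuous, and neighbourhoods of a
periodic path are detected by its blocks. *)
Lemma closed_BnP : (forall v : vertex E, exists y, rng (infpath_edge y 0) = v) ->
  closed (@Bn E n n_gt0) <-> closed (@periodic E n)°.
Proof.
move=> from; split=> cl.
  move=> x xcl; have xn : periodic n x.
    apply: closure_periodic; apply: closure_subset xcl.
    exact: interior_subset.
  apply: Bn_nbhs_periodic => //; apply: cl => A Ax.
  have [y [Py Ay]] := xcl _ (@segment_continuous E 0 n x _ Ax).
  by exists (segment 0 n y); split=> //; exact: nbhs_periodic_Bn.
move=> mu mucl; have cyc : is_cycle n_gt0 mu.
  apply: (@vertex_hausdorff E) => A B Ar Bs.
  have cr : nbhs mu (path_rng n_gt0 @^-1` A).
    exact: (@fpath_edge_continuous E n _ mu _ (@rng_continuous E _ _ Ar)).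
  have cs : nbhs mu (path_src n_gt0 @^-1` B).
    exact: (@fpath_edge_continuous E n _ mu _ (@src_continuous E _ _ Bs)).
  have [nu [[nucyc _] [Anu Bnu]]] := mucl _ (filterI cr cs).
  by exists (path_rng n_gt0 nu); split=> //; rewrite nucyc.
have [x xn xmu] := cycle_periodic cyc.
rewrite -xmu; apply: nbhs_periodic_Bn => //; apply: cl => A Ax.
have [k [N [k_gt0 Nmu NA]]] := periodic_nbhs_blocks xn Ax.
rewrite xmu in Nmu; have [nu [Bnu Nnu]] := mucl _ (open_nbhs_nbhs Nmu).
have [y yn ynu] := cycle_periodic Bnu.1; exists y; split.
  by apply: Bn_nbhs_periodic => //; rewrite ynu.
by apply: NA => j _; rewrite periodic_segment // ynu.
Qed.

End CyclesAndPeriodicPaths.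

(** * The isotropy of the boundary path groupoid *)

Section Groupoid.
Context {E : topological_graph}.
Implicit Types (x y z : infpath E) (g h : groupoid E).

Lemma groupoid_of k l x y : iter k (@shift E) x = iter l (@shift E) y ->
  exists g, [/\ grange g = x, gdegree g = (k%:Z - l%:Z)%R & gsource g = y].
Proof.
move=> xy; have hP : groupoid_set E (x, (k%:Z - l%:Z)%R, y) by exists k, l.
by exists (exist (fun t : infpath E * int * infpath E => t \in groupoid_set E)
  (x, (k%:Z - l%:Z)%R, y) (mem_set hP)).
Qed.

Lemma groupoid_nbhs_base g (A : set (groupoid E)) : nbhs g A ->
  exists i, [/\ groupoid_base_dom E i, groupoid_base i g & groupoid_base i `<=` A].
Proof.
rewrite nbhsE => -[B [[D' D'D DB] Bg] BA].
rewrite -DB in Bg; have [i D'i ig] := Bg; exists i; split=> //; first exact: D'D.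
by move=> h ih; apply: BA; rewrite -DB; exists i.
Qed.

Lemma base_nbhs_groupoid g (A B : set (infpath E)) k l :
  gdegree g = (k%:Z - l%:Z)%R ->
  iter k (@shift E) (grange g) = iter l (@shift E) (gsource g) ->
  nbhs (grange g) A -> nbhs (gsource g) B ->
  nbhs g (groupoid_base (A, B, (k, l))).
Proof.
move=> gkl klg Ag Bg.
have [U [oU Ug] Uinj] := iter_shift_locally_injective k (grange g).
have [V [oV Vg] Vinj] := iter_shift_locally_injective l (gsource g).
pose i := (A° `&` U, B° `&` V, (k, l)).
have Di : groupoid_base_dom E i.
  split; [by apply: openI => //; exact: open_interior..|move=> y z|move=> y z].
    by move=> /set_mem[_ Uy] /set_mem[_ Uz]; apply: Uinj; exact: mem_set.
  by move=> /set_mem[_ Vy] /set_mem[_ Vz]; apply: Vinj; exact: mem_set.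
rewrite nbhsE; exists (groupoid_base i).
  split; first by exists [set i]; [move=> _ ->|rewrite bigcup_set1].
  by split.
by move=> h [[Ah _] [Bh _] hkl klh]; split=> //; exact: interior_subset.
Qed.

(** A basic open set of isotropy elements around g forces sigma^k y = sigma^l y
for y near the range of g, since sigma^l is open and every such y is then the
range of an element of that set. Conversely, if sigma^k y = sigma^l y for all y
near the range of g, elements near g satisfy sigma^k y = sigma^l z = sigma^k z,
and sigma^k is locally injective. *)
Lemma interior_IsoP g : (Iso E)° g <-> grange g = gsource g /\
  exists k l, gdegree g = (k%:Z - l%:Z)%R /\
    nbhs (grange g) [set y | iter k (@shift E) y = iter l (@shift E) y].
Proof.
split=> [gI|[gg [k [l [gkl nkl]]]]].
  have gg : grange g = gsource g := interior_subset gI; split=> //.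
  have [[[U V] [k l]] [[oU oV _ _] [Ug Vg gkl klg] sub]] := groupoid_nbhs_base gI.
  exists k, l; split=> //.
  have nU : nbhs (grange g) U by exact: open_nbhs_nbhs.
  have /(@iter_shift_open E l) nV : nbhs (gsource g) V by exact: open_nbhs_nbhs.
  rewrite -klg in nV.
  apply: filterS (filterI nU (nbhs_iter_shift nV)).
  move=> y [Uy [z Vz zy]].
  have [h [hy hkl hz]] := groupoid_of (esym zy).
  have /sub : groupoid_base (U, V, (k, l)) h by split; rewrite ?hy ?hz.
  by rewrite /Iso /= hy hz => yz; rewrite -zy yz.
have [U [oU Ug] Uinj] := iter_shift_locally_injective k (grange g).
have nU : nbhs (grange g) U by exact: open_nbhs_nbhs.
have nUkl : nbhs (grange g)
    (U `&` [set y | iter k (@shift E) y = iter l (@shift E) y]).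
  exact: filterI.
have klg : iter k (@shift E) (grange g) = iter l (@shift E) (gsource g).
  by rewrite -gg; exact: nbhs_singleton nkl.
have nUkl' := nUkl; rewrite gg in nUkl'.
apply: filterS (base_nbhs_groupoid gkl klg nUkl nUkl').
move=> h [[Ur _] [Us sl] _ klh]; apply: Uinj; [exact: mem_set..|].
by rewrite klh sl.
Qed.

(** Degree n elements (x, n, x) with x in Fix(sigma^n) give one implication. For
the other, a limit of interior isotropy elements with sigma^(l+n) x = sigma^l x
yields sigma^l x as a limit of interior points of Fix(sigma^n). *)
Lemma closed_interior_IsoP : closed (Iso E)° <->
  forall n, (0 < n)%N -> closed (@periodic E n)°.
Proof.
split=> [cl n n_gt0 x xcl|cl g gcl].
  have xn : periodic n x.
    apply: closure_periodic; apply: closure_subset xcl.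
    exact: interior_subset.
  have [g [gx gn gx']] := @groupoid_of n 0 x x xn.
  have /interior_IsoP[_ [k [l [kl nkl]]]] : (Iso E)° g.
    apply: cl => A /groupoid_nbhs_base[[[U V] [k l]] [[oU oV _ _] [Ux Vx kl _] sub]].
    rewrite gx in Ux; rewrite gx' in Vx.
    have [y [Py [Uy Vy]]] := xcl _ (open_nbhs_nbhs (conj (openI oU oV) (conj Ux Vx))).
    have yn : periodic n y := nbhs_singleton Py.
    have [h [hy hn hy']] := @groupoid_of n 0 y y yn; exists h; split.
      apply/interior_IsoP; split; first by rewrite hy hy'.
      by exists n, 0%N; split=> //; rewrite hy.
    apply: sub; rewrite /groupoid_base /= hy hy'; split=> //.
      by rewrite hn -gn.
    have -> : k = (l + n)%N by move: kl; rewrite gn; lia.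
    by rewrite iterD yn.
  rewrite gx in nkl.
  have kE : k = (l + n)%N by move: kl; rewrite gn; lia.
  rewrite {}kE in nkl; apply: (@nbhs_periodic_iter_shift E n 0 l) => //.
have gg : grange g = gsource g.
  apply: infpath_hausdorff => A B Ag Bg.
  have [k [l [gkl klg]]] := set_valP g.
  have [h [hI [Ah Bh _ _]]] := gcl _ (base_nbhs_groupoid gkl klg Ag Bg).
  by exists (grange h); split=> //; rewrite (interior_subset hI : grange h = gsource h).
(* Used with l + n and l in the places of k and l, or of l and k, according to
   the sign of the degree. *)
have lim n l x : (0 < n)%N ->
    (forall A, nbhs x A -> exists y, [/\ A y,
      iter (l + n) (@shift E) y = iter l (@shift E) y & exists l',
      nbhs y [set z | iter (l' + n) (@shift E) z = iter l' (@shift E) z]]) ->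
    nbhs x [set z | iter (l + n) (@shift E) z = iter l (@shift E) z].
  move=> n_gt0 xlim.
  have : (periodic n)° (iter l (@shift E) x).
    apply: cl => // A /nbhs_iter_shift /xlim[y [Ay yl [l' yl']]].
    by exists (iter l (@shift E) y); split=> //; exact: nbhs_periodic_iter_shift yl'.
  move=> /nbhs_iter_shift; apply: filterS => z.
  by rewrite /periodic /= -iterD addnC.
have [k [l [gkl klg]]] := set_valP g.
apply/interior_IsoP; split=> //; exists k, l; split=> //.
have gnear A : nbhs (grange g) A -> exists y, [/\ A y,
    iter k (@shift E) y = iter l (@shift E) y & exists k' l',
    (k' + l = k + l')%N /\
    nbhs y [set z | iter k' (@shift E) z = iter l' (@shift E) z]].
  move=> Ag; have nT : nbhs (gsource g) setT by exact: filterT.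
  have [h [/interior_IsoP[hh [k' [l' [hkl' hn]]]] [Ah _ hkl klh]]] :=
    gcl _ (base_nbhs_groupoid gkl klg Ag nT).
  exists (grange h); split=> //; first by rewrite klh hh.
  by exists k', l'; split=> //; move: hkl'; rewrite hkl; lia.
case: (ltngtP k l) => [kl|kl|<-].
- have lE : l = (k + (l - k))%N by lia.
  have := lim (l - k)%N k (grange g); rewrite -lE.
  move=> /(_ _ _)/filterS; apply; [by move=> z| |]; first by rewrite subn_gt0.
  move=> A /gnear[y [Ay ykl [k' [l' [kl' yn]]]]]; exists y; split=> //.
  exists k'; have -> : (k' + (l - k) = l')%N by lia.
  by apply: filterS yn => z.
- have kE : k = (l + (k - l))%N by lia.
  have := lim (k - l)%N l (grange g); rewrite -kE.
  apply; first by rewrite subn_gt0.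
  move=> A /gnear[y [Ay ykl [k' [l' [kl' yn]]]]]; exists y; split=> //.
  by exists l'; have -> : (l' + (k - l) = k')%N by lia.
- exact: (@filterE _ (nbhs (grange g)) _).
Qed.

End Groupoid.

Theorem theorem3p6 (E : topological_graph) (hE : sg_vertices E = set0) :
  closed ((Iso E)°) <->
  (forall (n : nat) (n_gt0 : (0 < n)%N), closed (@Bn E n n_gt0)).
Proof.
rewrite closed_interior_IsoP.
by split=> cl n n_gt0; apply/(closed_BnP n_gt0 (infpath_from hE)); exact: cl.
Qed.
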